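(* Let $G$ be an abelian group with identity $e$, $R$ a $G$-graded $gr$-Noetherian ring, $M$ a graded $R$-module, $g\in G$, and let $N=\oplus_{h\in G}N_h$ and $N_i=\oplus_{h\in G}N_{i,h}$ ($i=1,\dots,n$, where $n\geq 2$) be graded submodules of $M$. Suppose that $N_g\subseteq N_{1,g}\cup N_{2,g}\cup\dots\cup N_{n,g}$, that at most two of $N_{1,g},N_{2,g},\dots,N_{n,g}$ are not $g$-$G2$-absorbing submodules of the $R_e$-module $M_g$, and that $Gr((N_{i,g}:_{R_e}M_g))\not\subseteq Gr((N_{k,g}:_{R_e}m))$ for all $m\in M_g\setminus N_{k,g}$ whenever $i\neq k$. Then $N_g\subseteq N_{i,g}$ for some $i\in\{1,\dots,n\}$.
   Context: All rings are commutative with identity and all modules are unitary. $G$ is an abelian multiplicative group with identity $e$. A $G$-graded ring is $R=\oplus_{g\in G}R_g$ with $R_gR_h\subseteq R_{gh}$; $R_e$ is a subring containing $1$. $R$ is $gr$-Noetherian if it satisfies the ascending chain condition on graded ideals. A graded $R$-module is $M=\oplus_{g\in G}M_g$ with $R_gM_h\subseteq M_{gh}$; each $M_g$ is an $R_e$-module. A submodule $N$ of $M$ is graded if $N=\oplus_h N_h$ with $N_h=N\cap M_h$; the degree-$h$ component of $N_i$ is written $N_{i,h}$. For a submodule $L$ of $M_g$ and $X$ an element or subset of $M_g$, $(L:_{R_e}X)=\{r\in R_e: rX\subseteq L\}$. For an ideal $A$ of $R_e$, $Gr(A)=\{x\in R_e: x^n\in A\text{ for some }n\geq 1\}$. A submodule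 $L$ of $M_g$ is $g$-$G2$-absorbing if $L\neq M_g$ and whenever $r,s\in R_e$, $m\in M_g$ with $rsm\in L$, then $r^{k_1}m\in L$ for some $k_1\in\mathbb{Z}^+$, or $s^{k_2}m\in L$ for some $k_2\in\mathbb{Z}^+$, or $rs\in(L:_{R_e}M_g)$. *)

(* Defs.v *)
From mathcomp Require Import all_boot all_algebra.
From mathcomp Require Import finmap all_classical.

Set Implicit Arguments.
Unset Strict Implicit.
Unset Printing Implicit Defensive.

Import GRing.Theory.
Local Open Scope classical_set_scope.
Local Open Scope ring_scope.

(* A grading of R (resp. M) is a family of subsets R_ : G -> set R (resp.
   M_ : G -> set M); the homogeneous components are subsets of the ambient
   type, and R_ 1%g is the subring written R_e on paper. Submodules of a
   component are likewise subsets of the ambient module. *)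

Section DirectSum.
Context {I : choiceType} {V : zmodType}.

Definition fsum (f : {fsfun I -> V with 0}) : V := \sum_(i <- finsupp f) f i.

Definition selections (A : I -> set V) : set {fsfun I -> V with 0} :=
  [set f | forall i, A i (f i)].

(* S is the internal direct sum of the additive subgroups A i: S is the set of
   finite sums of elements of the A i, and such a sum determines its terms. *)
Definition is_direct_sum (A : I -> set V) (S : set V) : Prop :=
  [/\ forall i, zmod_closed [in A i],
      S = [set fsum f | f in selections A]
    & forall f1 f2, selections A f1 -> selections A f2 ->
        fsum f1 = fsum f2 -> f1 = f2].

End DirectSum.

Section Graded.
Context {G : groupType} {R : comPzRingType}.
Implicit Types Re : set R.

Definition graded_ring (R_ : G -> set R) : Prop :=
  is_direct_sum R_ [set: R] /\
  forall g h r s, R_ g r -> R_ h s -> R_ (g * h)%g (r * s).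

Definition graded_module (R_ : G -> set R) (M : lmodType R) (M_ : G -> set M) :
    Prop :=
  is_direct_sum M_ [set: M] /\
  forall g h r x, R_ g r -> M_ h x -> M_ (g * h)%g (r *: x).

Definition graded_submodule (M : lmodType R) (M_ : G -> set M) (N : set M) :
    Prop :=
  GRing.submod_closed [in N] /\ is_direct_sum (fun h => N `&` M_ h) N.

(* Ideals of R are the submodules of the regular module R^o (not necessarily
   proper). *)
Definition graded_ideal (R_ : G -> set R) (J : set R) : Prop :=
  @graded_submodule R^o R_ J.

Definition gr_noetherian (R_ : G -> set R) : Prop :=
  forall J : nat -> set R, (forall k, graded_ideal R_ (J k)) ->
    (forall k, J k `<=` J k.+1) ->
  exists k0, forall k, (k0 <= k)%N -> J k = J k0.

Definition Gr Re (A : set R) : set R :=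
  [set x | Re x /\ exists2 k, (0 < k)%N & A (x ^+ k)].

Section Module.
Context {M : lmodType R}.
Implicit Types (Mg L X : set M).

Definition colon Re L X : set R :=
  [set r | Re r /\ forall x, X x -> L (r *: x)].

Definition submodule_of Re Mg L : Prop :=
  [/\ L `<=` Mg, zmod_closed [in L]
    & forall r x, Re r -> L x -> L (r *: x)].

Definition G2_absorbing Re Mg L : Prop :=
  [/\ submodule_of Re Mg L, L <> Mg
    & forall r s m, Re r -> Re s -> Mg m -> L ((r * s) *: m) ->
      [\/ exists2 k1, (0 < k1)%N & L (r ^+ k1 *: m),
          exists2 k2, (0 < k2)%N & L (s ^+ k2 *: m)
        | colon Re L Mg (r * s)]].

End Module.
End Graded.

(* Main.v *)
(* For [m] in [M_g] outside [N_{k,g}], the radical condition on [(i, k)] yields a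
   scalar [t] in [R_e] with [t M_g] inside [N_{i,g}] and [t m] still outside
   [N_{k,g}]. Hence, if no [N_{k,g}] contained [N_g], then starting from a point
   of [N_g] outside [N_{k,g}] and multiplying by one such scalar for each
   [i <> k] would give [y_k] in [N_g] lying in every [N_{i,g}] with [i <> k] but
   not in [N_{k,g}]. The sum of the [y_k] is congruent to [y_k] modulo
   [N_{k,g}] for every [k], so it lies in [N_g] but in no [N_{k,g}]. *)

Require Import Defs.
From mathcomp Require Import all_boot all_algebra.
From mathcomp Require Import finmap all_classical.

Import GRing.Theory.
Local Open Scope classical_set_scope.
Local Open Scope ring_scope.

(** The additive half of the argument: it involves subgroups only, no scalars. It fixes the index
    [i] for which the inclusion will be proved. Otherwise each [i] has a bad point [y i], and the
    sum of all of them escapes the cover. *)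
Lemma zmod_cover_factor (V : zmodType) (I : finType) (X : set V)
    (L : I -> set V) :
  zmod_closed [in X] -> (forall i, zmod_closed [in L i]) ->
  X `<=` \bigcup_(i in [set: I]) L i ->
  exists i, forall y, X y -> (forall j, j != i -> L j y) -> L i y.
Proof.
move=> X_zmod L_zmod X_cover; apply: contrapT => noi.
have /choice[y yP] i :
    exists z, [/\ X z, forall j, j != i -> L j z & ~ L i z].
  apply: contrapT => noz; apply: noi; exists i => z Xz Lz.
  by apply: contrapT => nLz; apply: noz; exists z.
have sum_closed (A : set V) (P : pred I) : zmod_closed [in A] ->
    (forall i, P i -> A (y i)) -> A (\sum_(i | P i) y i).
  move=> A_zmod Ay; have [A0 AD] := GRing.zmod_closedD A_zmod.
  apply/set_mem; apply: (big_ind (fun z => z \in [in A])) => [||i Pi] //.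
  by apply/mem_set/Ay.
have [i _] : (\bigcup_(i in [set: I]) L i) (\sum_i y i).
  by apply: X_cover; apply: sum_closed => // i _; have [] := yP i.
have [_ _ nLi] := yP i; apply: contra_not nLi.
rewrite (bigD1 i) //= => Lsum.
have Lrest : L i (\sum_(j | j != i) y j).
  apply: sum_closed => // j ji; have [_ + _] := yP j; apply.
  by rewrite eq_sym.
(* [y i] is the full sum minus the sum of the other [y j], and both lie in [L i]. *)
have [_ LB] := L_zmod i; apply/set_mem.
by rewrite -(addrK (\sum_(j | j != i) y j) (y i)); apply: LB; apply/mem_set.
Qed.

(** Induction on [s]: the scalar for the head is chosen for the point [y] already obtained from the
    tail, and stability of each [L j] under [Re] preserves the memberships gained before. *)
Lemma iterated_scaling_escape (R : comPzRingType) (M : lmodType R) (I : eqType)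
    (Re : set R) (Mg X K : set M) (L : I -> set M) (s : seq I) (m : M) :
  X `<=` Mg -> (forall r x, Re r -> X x -> X (r *: x)) ->
  (forall i r x, Re r -> L i x -> L i (r *: x)) ->
  (forall i x, i \in s -> Mg x -> ~ K x ->
    exists t, [/\ Re t, forall z, Mg z -> L i (t *: z) & ~ K (t *: x)]) ->
  X m -> ~ K m ->
  exists y, [/\ X y, forall i, i \in s -> L i y & ~ K y].
Proof.
move=> XM XZ LZ escape Xm nKm; elim: s escape => [|i s IHs] escape.
  by exists m; split.
have [j x js|y [Xy Ly nKy]] := IHs.
  by apply: escape; rewrite inE js orbT.
have [t [Ret tL nKty]] := escape i y (mem_head i s) (XM _ Xy) nKy.
exists (t *: y); split => // [|j]; first exact: XZ.
rewrite inE => /predU1P[-> | js]; first exact/tL/XM.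
exact/LZ/Ly.
Qed.

(** The scalar is a power [r ^+ k] multiplying [Mg] into [L], where [r] is in the first radical but
    not in the second. If it sent [m] into [K], the same exponent [k] would put [r] in the second
    radical. *)
Lemma not_sub_Gr_colon (R : comPzRingType) (M : lmodType R) (Re : set R)
    (Mg L K : set M) (m : M) :
  ~ (Gr Re (colon Re L Mg) `<=` Gr Re (colon Re K [set m])) ->
  exists t, [/\ Re t, forall z, Mg z -> L (t *: z) & ~ K (t *: m)].
Proof.
move=> nsub; apply: contrapT => not; apply: nsub => r [Rer [k k0 [Rerk rkL]]].
split=> //; exists k => //; split=> // _ ->.
by apply: contrapT => nK; apply: not; exists (r ^+ k).
Qed.

Lemma graded_submodule_component (G : groupType) (R : comPzRingType)
    (R_ : G -> set R) (M : lmodType R) (M_ : G -> set M) (N : set M) (g : G) :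
  graded_module R_ M_ -> graded_submodule M_ N ->
  submodule_of (R_ 1%g) (M_ g) (N `&` M_ g).
Proof.
move=> [_ M_Z] [[N0 NZD] [N_zmod _ _]]; split=> [x []// | | r x Rr [Nx Mx]].
  exact: N_zmod.
split; last by rewrite -[g]mul1g; apply: M_Z.
by apply/set_mem; rewrite -[r *: x]addr0; apply: NZD => //; apply/mem_set.
Qed.

Theorem theorem3p16 (G : groupType)
    (G_abelian : forall x y : G, (x * y)%g = (y * x)%g)
    (R : comPzRingType) (R_ : G -> set R) (R_graded : graded_ring R_)
    (R_noetherian : gr_noetherian R_)
    (M : lmodType R) (M_ : G -> set M) (M_graded : graded_module R_ M_)
    (g : G) (n : nat) (n_ge2 : (2 <= n)%N)
    (N : set M) (N_graded : graded_submodule M_ N)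
    (Ns : 'I_n -> set M) (Ns_graded : forall i, graded_submodule M_ (Ns i))
    (N_cover : N `&` M_ g `<=` \bigcup_(i in [set: 'I_n]) (Ns i `&` M_ g))
    (at_most_two :
      (#|[pred i : 'I_n |
           ~~ `[< G2_absorbing (R_ 1%g) (M_ g) (Ns i `&` M_ g) >]]| <= 2)%N)
    (radicals : forall i k : 'I_n, i <> k ->
      forall m, (M_ g `\` (Ns k `&` M_ g)) m ->
      ~ (Gr (R_ 1%g) (colon (R_ 1%g) (Ns i `&` M_ g) (M_ g)) `<=`
         Gr (R_ 1%g) (colon (R_ 1%g) (Ns k `&` M_ g) [set m]))) :
  exists i : 'I_n, N `&` M_ g `<=` Ns i `&` M_ g.
Proof.
have component (A : set M) : graded_submodule M_ A ->
    submodule_of (R_ 1%g) (M_ g) (A `&` M_ g).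
  exact: graded_submodule_component.
have L_sub i := component _ (Ns_graded i).
have [XM X_zmod XZ] := component _ N_graded.
have L_zmod i : zmod_closed [in Ns i `&` M_ g] by have [] := L_sub i.
have [k kP] := zmod_cover_factor _ _ _ _ X_zmod L_zmod N_cover.
exists k => m Xm; apply: contrapT => nLm.
(* Scaling [m] once for each index other than [k] gives a point [y] in all the other components but
   not in the [k]-th, against the choice of [k]. *)
have [i r x||||y [Xy Ly nLy]] := @iterated_scaling_escape _ _ _ (R_ 1%g) (M_ g)
  _ (Ns k `&` M_ g) (fun i => Ns i `&` M_ g) [seq i <- enum 'I_n | i != k] m
  XM XZ.
- by have [_ _] := L_sub i; apply.
- move=> i x; rewrite mem_filter => /andP[/eqP ik _] Mx nLx.
  exact/not_sub_Gr_colon/radicals.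
- exact: Xm.
- exact: nLm.
by apply/nLy/kP => // j jk; apply: Ly; rewrite mem_filter jk mem_enum.
Qed.
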